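(* Let $B$ be a $k$-adjacency basis of a graph $G=(V,E)$ of order $n\ge 7$, and let $G'=(V,E')$ be a graph on the same vertex set with $N_{G'}(x)=N_G(x)$ for every $x\in B$. If $\operatorname{adim}_k(G)=k+2$, then $\operatorname{adim}_k(G')=k+2$.
   Context: All graphs are finite and simple; $N_G(x)$ is the open neighbourhood of $x$ in $G$. For a graph $G=(V,E)$, $d_{G,2}(x,y)=\min\{d_G(x,y),2\}$ with $d_G$ the shortest-path distance ($\infty$ between different components). For distinct $x,y$, $\mathcal{C}_G(x,y)=\{z\in V: d_{G,2}(x,z)\ne d_{G,2}(y,z)\}$. A set $S\subseteq V$ is a $k$-adjacency generator if $|S\cap\mathcal{C}_G(x,y)|\ge k$ for all distinct $x,y$; a minimum-cardinality one is a $k$-adjacency basis and its size is $\operatorname{adim}_k(G)$. *)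

(* Defs.v *)
From mathcomp Require Import all_boot.

Set Implicit Arguments.
Unset Strict Implicit.
Unset Printing Implicit Defensive.

Record sgraph (V : finType) := SGraph {
  edge :> rel V;
  edge_sym : symmetric edge;
  edge_irrefl : irreflexive edge }.

Section Adjacency.
Variables (V : finType) (G : sgraph V).

Definition nbhd (x : V) : {set V} := [set y | G x y].

Definition walk_length (x y : V) (n : nat) : bool :=
  [exists p : n.-tuple V, path G x p && (last x p == y)].

Lemma connect_walk_length (x y : V) :
  connect G x y -> exists n, walk_length x y n.
Proof.
case/connectP => p Gp ->; exists (size p).
by apply/existsP; exists (in_tuple p); rewrite Gp eqxx.
Qed.

(* [None] stands for the infinite distance between distinct components. *)
Definition gdist (x y : V) : option nat :=
  match decP (@idP (connect G x y)) with
  | left xy => Some (ex_minn (connect_walk_length xy))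
  | right _ => None
  end.

Definition gdist2 (x y : V) : nat :=
  if gdist x y is Some d then minn d 2 else 2.

Definition distinguishers (x y : V) : {set V} :=
  [set z | gdist2 x z != gdist2 y z].

Definition adjacency_generator (k : nat) (S : {set V}) : bool :=
  [forall x, forall y, (x != y) ==> (k <= #|S :&: distinguishers x y|)].

Definition adjacency_basis (k : nat) (S : {set V}) : bool :=
  adjacency_generator k S &&
  [forall T : {set V}, adjacency_generator k T ==> (#|S| <= #|T|)].

(* All bases have the same cardinality, so the choice made by [pick] is
   immaterial; [None] means that there is no k-adjacency generator. *)
Definition adim (k : nat) : option nat :=
  omap (fun S : {set V} => #|S|) [pick S | adjacency_basis k S].

End Adjacency.

(* Main.v *)
(** For [z] in [B], which vertices lie at truncated distance 0, 1 or 2 from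
    [z] depends only on the neighbourhood of [z]; hence [B] is still a
    k-adjacency generator of [G'].  It is a smallest one because, for k > 0, no
    graph of order at least 7 has a k-adjacency generator with fewer than k + 2
    elements: given two landmarks, the at least five other vertices each see
    them at distance 1 or 2, so two of these vertices agree on both landmarks
    and at most |S| - 2 elements of the generator [S] distinguish them. *)
Require Import Defs.
From mathcomp Require Import all_boot.

Section Adjacency.
Variables (V : finType) (G : sgraph V).
Implicit Types (x y z : V) (S T : {set V}) (k : nat).

Lemma walk_length0 x y : walk_length G x y 0 = (x == y).
Proof.
apply/existsP/eqP => [[p]|->]; last by exists [tuple]; rewrite /= eqxx.
by rewrite (tuple0 p) /= => /eqP.
Qed.

Lemma walk_length1 x y : walk_length G x y 1 = G x y.
Proof.
apply/existsP/idP => [[p]|Gxy]; last by exists [tuple y]; rewrite /= Gxy eqxx.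
by case/tupleP: p => z p; rewrite (tuple0 p) /= andbT => /andP[Gxz /eqP <-].
Qed.

(** A walk of length 0 means equality and one of length 1 an edge; every longer distance, like the
    infinite one between components, is truncated to 2. *)
Lemma gdist2E x y :
  gdist2 G x y = if x == y then 0 else if G x y then 1 else 2.
Proof.
rewrite /gdist2 /gdist; case: decP => [xy|nxy].
  case: ex_minnP => -[|[|m]] walk_m min_m.
  - by rewrite -walk_length0 walk_m.
  - rewrite -(walk_length1 x y) walk_m -walk_length0.
    by case: ifP => // /min_m.
  - rewrite -walk_length0 -walk_length1 (minn_idPr _) //.
    by case: ifP => [/min_m|_] //; case: ifP => // /min_m.
case: eqP => [eq_xy|_]; first by case: nxy; rewrite eq_xy connect0.
by case: ifP => // Gxy; case: nxy; apply: connect1.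
Qed.

Lemma adjacency_generatorP k S :
  reflect (forall x y, x != y -> k <= #|S :&: distinguishers G x y|)
          (adjacency_generator G k S).
Proof.
apply: (iffP 'forall_forallP) => gen x y; first exact/implyP.
by apply/implyP; apply: gen.
Qed.

Lemma adjacency_basisP k S :
  reflect (adjacency_generator G k S /\
           forall T, adjacency_generator G k T -> #|S| <= #|T|)
          (adjacency_basis G k S).
Proof.
apply: (iffP andP) => -[genS minS]; split=> //.
  by move=> T; apply/implyP/(forallP minS).
by apply/forallP => T; apply/implyP/minS.
Qed.

Lemma adim_basis k S : adjacency_basis G k S -> adim G k = Some #|S|.
Proof.
move=> basisS; rewrite /adim; case: pickP => [T basisT|/(_ S)]; last first.
  by rewrite basisS.
have [genS minS] := adjacency_basisP _ _ basisS.
have [genT minT] := adjacency_basisP _ _ basisT.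
by congr Some; apply/eqP; rewrite eqn_leq minS ?minT.
Qed.

Lemma adjacency_generator0 S : adjacency_generator G 0 S.
Proof. exact/adjacency_generatorP. Qed.

Lemma undistinguished_pair z1 z2 : 7 <= #|V| ->
  exists x y, x != y /\ [disjoint distinguishers G x y & [set z1; z2]].
Proof.
move=> V7; pose W := ~: [set z1; z2]; pose f x := (G x z1, G x z2).
have: ~~ dinjectiveb f W.
  apply/negP => /dinjectiveP /card_in_image card_fW.
  (* If [f] were injective on [W], then [W] would have at most 2 * 2 elements and [V] at most 2 + 4
     < 7; the case [z1 = z2] only lowers this count. *)
  have := max_card [in image f W]; rewrite card_fW card_prod card_bool.
  rewrite leqNgt => /negP[]; rewrite -(ltn_add2l #|[set z1; z2]|) cardsC.
  by apply: leq_trans V7; rewrite ltnS (leq_add2r 4 _ 2) cards2; case: eqP.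
case/dinjectivePn => x + [y /andP[ne_yx] + [f1 f2]].
rewrite !inE !negb_or => /andP[nx1 nx2] /andP[ny1 ny2].
exists x, y; rewrite eq_sym ne_yx; split=> //; rewrite disjoint_sym.
rewrite disjoint_subset; apply/subsetP => z.
(* Since [x] and [y] avoid [z1] and [z2], equal values of [f] force equal truncated distances to
   both. *)
rewrite !inE !gdist2E negbK => /orP[]/eqP->.
  by rewrite f1 (negPf nx1) (negPf ny1) eqxx.
by rewrite f2 (negPf nx2) (negPf ny2) eqxx.
Qed.

Lemma adjacency_generator_card k S : 7 <= #|V| -> 0 < k ->
  adjacency_generator G k S -> k + 2 <= #|S|.
Proof.
move=> V7 k0 /adjacency_generatorP genS.
have bound z1 z2 : k <= #|S :\: [set z1; z2]|.
  have [x [y [ne_xy dis]]] := undistinguished_pair z1 z2 V7.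
  apply: leq_trans (genS x y ne_xy) _; apply/subset_leq_card/subsetP => z.
  rewrite !(in_setI, in_setD) => /andP[-> xyz]; rewrite andbT.
  by rewrite (disjointFr dis xyz).
(* As [k] is positive, [bound] at a repeated vertex produces an element of [S] other than that
   vertex: first [z1] from an arbitrary [x0], then [z2] from [z1]. Now [bound z1 z2] counts the rest
   of [S]. *)
have /card_gt0P[x0 _] : 0 < #|V| by apply: leq_trans V7.
have /card_gt0P[z1] := leq_trans k0 (bound x0 x0).
rewrite inE => /andP[_ Sz1].
have /card_gt0P[z2] := leq_trans k0 (bound z1 z1).
rewrite !inE orbb => /andP[ne21 Sz2].
rewrite -(cardsID [set z1; z2] S) addnC leq_add ?bound //.
have /setIidPr-> : [set z1; z2] \subset S by rewrite subUset !sub1set Sz1.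
by rewrite cards2 eq_sym ne21.
Qed.

End Adjacency.

Lemma eq_nbhd_adjacency_generator (V : finType) (G G' : sgraph V) (k : nat)
    (S : {set V}) :
  (forall x, x \in S -> nbhd G' x = nbhd G x) ->
  adjacency_generator G k S -> adjacency_generator G' k S.
Proof.
move=> eqN /adjacency_generatorP genS; apply/adjacency_generatorP => x y.
have eqG u z : z \in S -> gdist2 G' u z = gdist2 G u z.
  move=> /eqN /setP/(_ u); rewrite !inE !gdist2E.
  (* By symmetry of adjacency, the neighbourhood of the landmark [z] decides how far any [u] is from
     it. *)
  by rewrite (edge_sym G') (edge_sym G) => ->.
move=> /genS /leq_trans; apply; apply/subset_leq_card/subsetP => z.
by rewrite !inE => /andP[Sz]; rewrite Sz !eqG.
Qed.

Theorem theorem23 (V : finType) (G G' : sgraph V) (k : nat) (B : {set V})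
    (order_ge7 : 7 <= #|V|)
    (basisB : adjacency_basis G k B)
    (eq_nbhd : forall x : V, x \in B -> nbhd G' x = nbhd G x)
    (adimG : adim G k = Some (k + 2)) :
  adim G' k = Some (k + 2).
Proof.
have cardB : #|B| = k + 2.
  by move: adimG; rewrite (adim_basis _ _ _ _ basisB) => -[].
have [genB minB] := adjacency_basisP _ _ _ _ basisB.
(* For [k = 0] the empty set is a generator, so a basis would be empty rather than of size 2. *)
have k0 : 0 < k.
  case: k minB cardB {adimG basisB genB} => // minB cardB.
  by have := minB set0 (adjacency_generator0 _ _ _); rewrite cardB cards0.
rewrite -cardB; apply: adim_basis; apply/adjacency_basisP; split.
  exact: eq_nbhd_adjacency_generator genB.
by move=> T; rewrite cardB; apply: adjacency_generator_card.
Qed.
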